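(* Let $S$ be a factorizable inverse monoid (with zero) with semilattice $E$ of idempotents and group $G$ of units such that the natural connection $\theta$ is a dual isomorphism from $E$ to a sublattice of $L(G)$. Then $S$ is $G$-nilpotent (resp., $G$-solvable) if and only if $G$ is nilpotent (resp., solvable) and $E\theta=\{e\theta : e\in E\}$ contains (all terms of) a central series (resp., an abelian series) of $G$.
   Context: All inverse monoids have a zero $0$ and identity $1$. For an inverse monoid $S$, $E$ is its semilattice of idempotents, $G$ its group of units, and $\leq$ is the natural partial order ($a\leq b$ iff $a=eb$ for some $e\in E$). $S$ is factorizable if $S=EG$ (equivalently $S=GE$). $L(G)$ is the lattice of subgroups of $G$. The natural connection is $\theta:E\to L(G)$, $e\theta=\{g\in G: eg=e\}$. That $\theta$ is a dual isomorphism from $E$ to a sublattice of $L(G)$ means: $\theta$ is injective, its image is a sublattice of $L(G)$, and $e\leq f\iff f\theta\subseteq e\theta$. For an idempotent $e$, $e^{\upharpoonright}=\{s\in S: e\leq s\}$. An element $c$ of an inverse semigroup $T$ is central in $T$ if $ct=tc$ for all $t\in T$; $Z(T)$ is the set of central elements. For idempotents $e,f$ with $f$ central in $e^{\upharpoonright}$ (in particular $e\le f$), $F_{e,f}=fe^{\upharpoonright}=\{fs: s\in e^{\upharpoonright}\}$, an inverse semigroup with identity $f$ (so $F_{0,f}=fS$). For $S$ as in the claim, a chain $0=e_0\leq e_1\leq\cdots\leq e_n=1$ of central idempotents of $S$ is a $G$-nilpotent series (resp. $G$-solvable series) if $F_{e_i,e_{i+1}}\subseteq Z(F_{0,e_{i+1}})$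 (resp. $F_{e_i,e_{i+1}}$ is a commutative semigroup) for all $0\leq i\leq n-1$. $S$ is $G$-nilpotent (resp. $G$-solvable) if it has a $G$-nilpotent (resp. $G$-solvable) series. A normal series $1=G_0\leq G_1\leq\cdots\leq G_n=G$ of a group $G$ (each $G_i$ normal in $G$) is a central series (resp. abelian series) if $G_{i+1}/G_i\leq Z(G/G_i)$ (resp. $G_{i+1}/G_i$ is abelian) for all $0\leq i\leq n-1$; $G$ is nilpotent (resp. solvable) if it has a central (resp. abelian) series. *)

(* Defs.v *)
From HB Require Import structures.
From mathcomp Require Import all_boot.
From mathcomp Require Import boolp classical_sets.

Set Implicit Arguments.
Unset Strict Implicit.
Unset Printing Implicit Defensive.

Local Open Scope classical_set_scope.
Local Open Scope group_scope.

(** Inverse monoids with zero. The unique [b] below is the inverse of [a]. *)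
HB.mixin Record Monoid_isInverse0 S of Monoid S := {
  zerog : S;
  mul0g : forall a : S, zerog * a = zerog;
  mulg0 : forall a : S, a * zerog = zerog;
  uniq_inverse : forall a : S, exists! b : S, a * b * a = a /\ b * a * b = b
}.

#[short(type="inverseMonoid0Type")]
HB.structure Definition InverseMonoid0 :=
  { S of Monoid_isInverse0 S & Monoid S }.

(** The group of units of a monoid. A unit is stored together with its
    two-sided inverse, which it determines uniquely. *)
Section Units.
Variable S : monoidType.

Record units := Units {
  units_pair : S * S;
  _ : (units_pair.1 * units_pair.2 == 1) && (units_pair.2 * units_pair.1 == 1)
}.

HB.instance Definition _ := [isSub for units_pair].
HB.instance Definition _ := [Choice of units by <:].

Definition unit_val (u : units) : S := (units_pair u).1.
Definition unit_inv (u : units) : S := (units_pair u).2.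

Lemma unit_mulV u : unit_val u * unit_inv u = 1.
Proof. by case: u => p up; case/andP: (up) => /eqP. Qed.

Lemma unit_mulVl u : unit_inv u * unit_val u = 1.
Proof. by case: u => p up; case/andP: (up) => _ /eqP. Qed.

Lemma unit_val_inj : injective unit_val.
Proof.
move=> u v uv; apply: val_inj.
suff uv' : unit_inv u = unit_inv v.
  by move: uv uv'; rewrite /unit_val /unit_inv /=;
    case: (units_pair u) (units_pair v) => [a b] [c d] /= -> ->.
by rewrite -[LHS]mulg1 -(unit_mulV v) -uv mulgA unit_mulVl mul1g.
Qed.

Definition units_one : units :=
  @Units (1, 1) (introT andP (conj (introT eqP (mul1g 1)) (introT eqP (mul1g 1)))).

Lemma units_mul_subproof u v :
  let p := (unit_val u * unit_val v, unit_inv v * unit_inv u) in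
  (p.1 * p.2 == 1) && (p.2 * p.1 == 1).
Proof.
rewrite /=; apply/andP; split; apply/eqP.
  by rewrite mulgA -(mulgA (unit_val u)) unit_mulV mulg1 unit_mulV.
by rewrite mulgA -(mulgA (unit_inv v)) unit_mulVl mulg1 unit_mulVl.
Qed.
Definition units_mul u v : units := Units (units_mul_subproof u v).

Lemma units_inv_subproof u :
  let p := (unit_inv u, unit_val u) in
  (p.1 * p.2 == 1) && (p.2 * p.1 == 1).
Proof. by rewrite /= unit_mulV unit_mulVl !eqxx. Qed.
Definition units_inv u : units := Units (units_inv_subproof u).

Lemma units_mulA : associative units_mul.
Proof. by move=> u v w; apply: unit_val_inj; rewrite /unit_val /= mulgA. Qed.
Lemma units_mul1 : left_id units_one units_mul.
Proof. by move=> u; apply: unit_val_inj; rewrite /unit_val /= mul1g. Qed.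
Lemma units_mulr1 : right_id units_one units_mul.
Proof. by move=> u; apply: unit_val_inj; rewrite /unit_val /= mulg1. Qed.
Lemma units_mulV : left_inverse units_one units_inv units_mul.
Proof. by move=> u; apply: unit_val_inj; rewrite [LHS]unit_mulVl. Qed.
Lemma units_mulVr : right_inverse units_one units_inv units_mul.
Proof. by move=> u; apply: unit_val_inj; rewrite [LHS]unit_mulV. Qed.

HB.instance Definition _ := isMonoid.Build units units_mulA units_mul1 units_mulr1.
HB.instance Definition _ := hasInv.Build units units_inv.
HB.instance Definition _ := Monoid_isGroup.Build units units_mulV units_mulVr.

End Units.

(** Centers and commutativity are stated for a subset [A] of a type carrying
    an operation, so as to apply to the subsemigroups [F_{e,f}] and to
    quotient groups, whose elements are cosets. *)
Definition center_of (T : Type) (op : T -> T -> T) (A : set T) : set T :=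
  [set c | A c /\ forall t, A t -> op c t = op t c].

Definition commutative_on (T : Type) (op : T -> T -> T) (A : set T) : Prop :=
  forall x y, A x -> A y -> op x y = op y x.

Section Groups.
Variable G : groupType.
Implicit Types (A B N : set G).

Definition is_subgroup (H : set G) : Prop :=
  [/\ H 1, (forall x y, H x -> H y -> H (x * y)) & (forall x, H x -> H x^-1)].

Definition is_normal N : Prop :=
  is_subgroup N /\ forall x g, N x -> N (x ^ g).

(** The join of two subgroups in L(G); their meet is the intersection. *)
Definition subgroup_join A B : set G :=
  [set x | forall H : set G, is_subgroup H -> A `<=` H -> B `<=` H -> H x].

Definition is_sublattice (L : set (set G)) : Prop :=
  [/\ L `<=` is_subgroup,
      (forall A B, L A -> L B -> L (A `&` B)) &
      (forall A B, L A -> L B -> L (subgroup_join A B))].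

Definition set_mul A B : set G := [set a * b | a in A & b in B].
Definition coset_of_elt N (x : G) : set G := [set x * y | y in N].

(** [H / N], as a set of cosets multiplied by [set_mul]. *)
Definition quotient_set (H N : set G) : set (set G) := [set coset_of_elt N x | x in H].

Definition normal_series (n : nat) (H : nat -> set G) : Prop :=
  [/\ H 0 = [set 1], H n = setT,
      (forall i, i <= n -> is_normal (H i)) &
      (forall i, i < n -> H i `<=` H i.+1)].

Definition central_series (n : nat) (H : nat -> set G) : Prop :=
  normal_series n H /\
  forall i, i < n ->
    quotient_set (H i.+1) (H i) `<=` center_of set_mul (quotient_set setT (H i)).

Definition abelian_series (n : nat) (H : nat -> set G) : Prop :=
  normal_series n H /\
  forall i, i < n -> commutative_on set_mul (quotient_set (H i.+1) (H i)).

Definition nilpotent_group : Prop := exists n H, central_series n H.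
Definition solvable_group : Prop := exists n H, abelian_series n H.

End Groups.

Section InverseMonoids.
Variable S : inverseMonoid0Type.
Implicit Types (a b f s : S).

Definition idempotents : set S := [set e | e * e = e].

Definition nat_le a b : Prop := exists2 e, idempotents e & a = e * b.

Definition factorizable : Prop :=
  forall s, exists2 e, idempotents e & exists g : units S, s = e * unit_val g.

(** The natural connection; it is only used at idempotents [e]. *)
Definition natural_connection (e : S) : set (units S) := [set g : units S | e * unit_val g = e].

Definition natural_connection_image : set (set (units S)) :=
  [set natural_connection e | e in idempotents].

Definition natural_connection_dual_iso : Prop :=
  [/\ (forall e f, idempotents e -> idempotents f ->
         natural_connection e = natural_connection f -> e = f),
      is_sublattice natural_connection_image &
      (forall e f, idempotents e -> idempotents f ->
         (nat_le e f <-> natural_connection f `<=` natural_connection e))].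

Definition up_set (e : S) : set S := [set s | nat_le e s].

(** [F_{e,f}]; meaningful when [f] is central in [up_set e]. *)
Definition F_set (e f : S) : set S := [set f * s | s in up_set e].

Definition central_idempotent_chain (n : nat) (e : nat -> S) : Prop :=
  [/\ e 0 = zerog, e n = 1,
      (forall i, i <= n -> idempotents (e i) /\ center_of mul setT (e i)) &
      (forall i, i < n -> nat_le (e i) (e i.+1))].

Definition G_nilpotent_series (n : nat) (e : nat -> S) : Prop :=
  central_idempotent_chain n e /\
  forall i, i < n ->
    F_set (e i) (e i.+1) `<=` center_of mul (F_set zerog (e i.+1)).

Definition G_solvable_series (n : nat) (e : nat -> S) : Prop :=
  central_idempotent_chain n e /\
  forall i, i < n -> commutative_on mul (F_set (e i) (e i.+1)).

Definition G_nilpotent : Prop := exists n e, G_nilpotent_series n e.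
Definition G_solvable : Prop := exists n e, G_solvable_series n e.

End InverseMonoids.

Arguments factorizable S : clear implicits.
Arguments natural_connection_image S : clear implicits.
Arguments natural_connection_dual_iso S : clear implicits.
Arguments G_nilpotent S : clear implicits.
Arguments G_solvable S : clear implicits.

(* Main.v *)
(** A central idempotent [e] has normal stabilizer [e theta], and conversely by
    injectivity of [theta], since [theta] turns conjugation of idempotents into
    conjugation of subgroups. So chains of central idempotents correspond, in
    reversed order, to normal series with terms in [E theta]. For such [e <= f],
    every element of [F_{e,f}] has the form [f k g] with [k >= e] idempotent and
    [g] in [e theta]. Commutation of [g] and [h] modulo [f theta] means
    [f g h = f h g]; injectivity of [theta] then forces the idempotents [f k] to
    commute with the relevant units as well, so that [F_{e,f}] and [F_{e',f}]
    commute elementwise iff [e theta / f theta] and [e' theta / f theta] do. The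
    nilpotent case is [e' = 0], the solvable case is [e' = e]. *)
Require Import Defs.
From mathcomp Require Import all_boot.
From mathcomp Require Import boolp classical_sets.

Set Implicit Arguments.
Unset Strict Implicit.
Unset Printing Implicit Defensive.

Local Open Scope classical_set_scope.
Local Open Scope group_scope.

Definition commute_on (T : Type) (op : T -> T -> T) (A B : set T) : Prop :=
  forall x y, A x -> B y -> op x y = op y x.

Section InverseMonoidTheory.
Variable S : inverseMonoid0Type.
Implicit Types (a b e f k l p s t : S) (g h x y : units S).

(* [mulgA] at [S]: rewriting right-to-left with the generic lemma infers another
   presentation of the magma instance, which later rewrites fail to match. *)
Lemma mulSA a b c : a * (b * c) = a * b * c.
Proof. exact: mulgA. Qed.

(** * Idempotents of an inverse monoid *)

Lemma inverse_unique a b c :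
  a * b * a = a -> b * a * b = b -> a * c * a = a -> c * a * c = c -> b = c.
Proof.
move=> ab ba ac ca; have [d [_ du]] := uniq_inverse a.
by rewrite -(du b) // -(du c).
Qed.

(** If [d] is the inverse of [e * f], then [f * d * e] is also one, so both agree and [d] is
    idempotent. An idempotent is its own inverse, hence [e * f = d]. *)
Lemma idempotentsM e f : idempotents e -> idempotents f -> idempotents (e * f).
Proof.
rewrite /idempotents /= => ee ff.
have [d [[d1 d2] _]] := uniq_inverse (e * f).
have fdeE : f * d * e = d.
  apply: (@inverse_unique (e * f)) => //.
    by rewrite !mulSA -(mulSA e f f) ff -(mulSA (e * f * d) e e) ee -mulSA -[RHS]d1 !mulSA.
  rewrite !mulSA -(mulSA (f * d) e e) ee -(mulSA (f * d * e) f f) ff.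
  by rewrite -[in RHS]d2 !mulSA.
have dd : d * d = d.
  by rewrite -{1 2}fdeE -[RHS]fdeE -[in RHS]d2 !mulSA.
suff -> : e * f = d by [].
by apply: (@inverse_unique d) => //; rewrite !dd.
Qed.

(** Both [e * f] and [f * e] are inverses of [e * f]. *)
Lemma idempotents_commute e f : idempotents e -> idempotents f -> e * f = f * e.
Proof.
move=> ee ff; have ef := idempotentsM ee ff; have fe := idempotentsM ff ee.
move: ee ff ef fe; rewrite /idempotents /= => ee ff ef fe.
apply: (@inverse_unique (e * f)); rewrite ?ef //.
  by rewrite !mulSA -(mulSA e f f) ff -(mulSA _ e e) ee -mulSA ef.
by rewrite !mulSA -(mulSA f e e) ee -(mulSA _ f f) ff -mulSA fe.
Qed.

Lemma idempotents0 : idempotents (zerog : S).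
Proof. exact: mul0g. Qed.

Lemma idempotents1 : idempotents (1 : S).
Proof. exact: mulg1. Qed.

Lemma center0 : center_of mul setT (zerog : S).
Proof. by split=> // t _; rewrite mul0g mulg0. Qed.

Lemma nat_le0 s : nat_le zerog s.
Proof. by exists zerog; [exact: idempotents0 | rewrite mul0g]. Qed.

Lemma nat_le_mul e f : idempotents f -> nat_le e f -> e * f = e.
Proof. by move=> ff [k _ ->]; rewrite -mulSA ff. Qed.

(* [unit_val] typed in [S] itself, so that all products below are taken in the
   same magma instance. *)
Definition uval g : S := unit_val g.

Lemma uvalM g h : uval (g * h) = uval g * uval h.
Proof. by []. Qed.

Lemma natural_connectionE e g : natural_connection e g = (e * uval g = e).
Proof. by []. Qed.

Lemma uvalVl g : uval g^-1 * uval g = 1.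
Proof. exact: unit_mulVl. Qed.

Lemma uvalV g : uval g * uval g^-1 = 1.
Proof. exact: unit_mulV. Qed.

Lemma mul_unitVK g a : a * uval g^-1 * uval g = a.
Proof. by rewrite -mulSA uvalVl mulg1. Qed.

Lemma mul_unitK g a : a * uval g * uval g^-1 = a.
Proof. by rewrite -mulSA uvalV mulg1. Qed.

Lemma idempotents_conj e g :
  idempotents e -> idempotents (uval g^-1 * e * uval g).
Proof.
by rewrite /idempotents /= => ee; rewrite !mulSA mul_unitK -(mulSA _ e e) ee.
Qed.

(** * The subgroups [natural_connection e] and their cosets *)

Lemma natural_connection0 : natural_connection (zerog : S) = setT.
Proof. by apply/seteqP; split=> // g _; exact: mul0g. Qed.

Lemma natural_connection1 : natural_connection (1 : S) = [set 1].
Proof.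
apply/seteqP; split=> g; rewrite !natural_connectionE mul1g.
  by move=> g1; exact: unit_val_inj.
by move->.
Qed.

Lemma natural_connectionM e x y :
  natural_connection e x -> natural_connection e y -> natural_connection e (x * y).
Proof. by rewrite !natural_connectionE mulSA => -> ->. Qed.

Lemma natural_connectionV e x :
  natural_connection e x -> natural_connection e x^-1.
Proof. by rewrite !natural_connectionE => ex; rewrite -{1}ex mul_unitK. Qed.

Lemma natural_connection_subgroup e : is_subgroup (natural_connection e).
Proof.
split; [exact: mulg1 | exact: natural_connectionM | exact: natural_connectionV].
Qed.

Lemma natural_connection_conj e g x :
  natural_connection (uval g^-1 * e * uval g) x <->
  natural_connection e (g * x * g^-1).
Proof.
rewrite !natural_connectionE !uvalM.
split=> [/(congr1 (fun a => uval g * a * uval g^-1)) | egx].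
  by rewrite !mulSA uvalV mul1g mul_unitK.
by rewrite -[in RHS]egx !mulSA mul_unitVK.
Qed.

Lemma central_natural_connection_normal e :
  center_of mul setT e -> is_normal (natural_connection e).
Proof.
move=> [_ ec]; split; first exact: natural_connection_subgroup.
move=> x g; rewrite !natural_connectionE => ex.
by rewrite !uvalM mulSA ec // -mulSA (mulSA e) ex ec // mulSA uvalVl mul1g.
Qed.

(** Cancelling [g] gives [e * k = e * g^-1], an idempotent. As [e] is central, squaring yields
    [e * g^-1 * g^-1 = e * g^-1], and [g^-1] cancels. *)
Lemma absorb_idempotent_unit e k g : center_of mul setT e -> idempotents e ->
  idempotents k -> e * (k * uval g) = e -> e * k = e /\ e * uval g = e.
Proof.
move=> [_ ec] ee kk ekg.
have ekE : e * k = e * uval g^-1 by rewrite -[in RHS]ekg mulSA mul_unitK.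
have ek := idempotentsM ee kk.
have ekgg : e * uval g^-1 * uval g^-1 = e * uval g^-1.
  move: ek; rewrite ekE /idempotents /= => {2}<-.
  by rewrite !mulSA -(mulSA e _ e) -ec // mulSA ee.
have eV : e * uval g^-1 = e.
  by move/(congr1 (mul^~ (uval g))): ekgg => /=; rewrite !mul_unitVK.
by rewrite ekE; split=> //; rewrite -{1}eV mul_unitVK.
Qed.

(** The central [f] absorbs the elements of [N], so a product of cosets can be tested on
    representatives after multiplying by [f]. *)
Lemma coset_commute_iff f g h : center_of mul setT f ->
  let N := natural_connection f in
  set_mul (coset_of_elt N g) (coset_of_elt N h) =
    set_mul (coset_of_elt N h) (coset_of_elt N g) <->
  f * uval g * uval h = f * uval h * uval g.
Proof.
move=> [_ fc] N.
have NE x a : N x -> f * (uval x * a) = f * a by rewrite mulSA => ->.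
have fCA x a : f * (uval x * a) = uval x * (f * a) by rewrite mulSA (fc (uval x)) // -mulSA.
have prodE x m y n : N m -> N n ->
    f * uval (x * m * (y * n)) = f * (uval x * uval y).
  move=> Nm Nn; rewrite !uvalM.
  by rewrite -(mulSA (uval x)) fCA NE // fCA Nn [RHS]fCA (fc (uval y)).
have sub x y : f * (uval x * uval y) = f * (uval y * uval x) ->
    set_mul (coset_of_elt N x) (coset_of_elt N y) `<=`
    set_mul (coset_of_elt N y) (coset_of_elt N x).
  move=> xy _ [_ [m Nm <-] [_ [n Nn <-] <-]].
  exists y; first by exists 1; [exact: mulg1 | rewrite mulg1].
  exists (y^-1 * (x * m * (y * n))); last by rewrite !mulgA mulgV mul1g.
  (* This element of [N] is the commutator of [x] and [y] up to [m] and [n]; [xy] makes [f] absorb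
     it. *)
  exists (x^-1 * (y^-1 * (x * m * (y * n)))); last by rewrite !mulgA mulgV mul1g.
  rewrite /N !natural_connectionE.
  rewrite -[uval (_ * _)]/(uval x^-1 * (uval y^-1 * uval (x * m * (y * n)))).
  by rewrite 2!fCA prodE // xy -2!fCA !mulSA !mul_unitVK.
rewrite -!mulSA; split=> [gh | gh]; last by apply/seteqP; split; apply: sub.
have : set_mul (coset_of_elt N g) (coset_of_elt N h) (g * h).
  exists g; first by exists 1; [exact: mulg1 | rewrite mulg1].
  by exists h => //; exists 1; [exact: mulg1 | rewrite mulg1].
(* Now [g * h] has the form [h * m * (g * n)], and [f] absorbs [m] and [n]. *)
rewrite gh => -[_ [m Nm <-] [_ [n Nn <-] /(congr1 uval)]].
by move=> /(congr1 (mul f)); rewrite prodE.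
Qed.

(** * Factorization above a central idempotent *)

Hypothesis factS : factorizable S.

Lemma center_of_unit_commute e : idempotents e ->
  (forall g, e * uval g = uval g * e) -> center_of mul setT e.
Proof.
move=> ee eu; split=> // t _; have [k kk [g ->]] := factS t.
by rewrite mulSA (idempotents_commute ee kk) -!mulSA eu.
Qed.

Lemma up_set_factorization e s : center_of mul setT e -> idempotents e ->
  up_set e s -> exists k g, [/\ idempotents k, e * k = e,
    natural_connection e g & s = k * uval g].
Proof.
move=> ec ee [d dd es]; have [k kk [g sE]] := factS s.
exists k, g; have /absorb_idempotent_unit [//|//|//| ek eg] : e * (k * uval g) = e.
  have {1}-> : e = e * d by rewrite (idempotents_commute ee dd) es mulSA dd.
  by rewrite -mulSA -sE -es.
by split.
Qed.

(** * Commutation with units, from injectivity of [theta] *)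

Hypothesis thetaS : natural_connection_dual_iso S.

Lemma natural_connection_inj e f : idempotents e -> idempotents f ->
  natural_connection e = natural_connection f -> e = f.
Proof. by case: thetaS => inj _ _; exact: inj. Qed.

(** The idempotents [g^-1 * e * g] and [e] have the same image under [theta], hence coincide. *)
Lemma conj_stable_commute e g : idempotents e ->
  (forall x, natural_connection e (g * x * g^-1) <-> natural_connection e x) ->
  e * uval g = uval g * e.
Proof.
move=> ee ex.
have {2}<- : uval g^-1 * e * uval g = e.
  apply: natural_connection_inj => //; first exact: idempotents_conj.
  by apply/seteqP; split=> x => [/natural_connection_conj/ex|/ex/natural_connection_conj].
by rewrite !mulSA uvalV mul1g.
Qed.

Lemma normal_natural_connection_central e : idempotents e ->
  is_normal (natural_connection e) -> center_of mul setT e.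
Proof.
move=> ee [_ en]; apply: center_of_unit_commute => // g.
apply: conj_stable_commute => // x; split=> [/en | /en] => [/(_ g)|/(_ g^-1)].
  by rewrite /conjg !mulgA mulVg mul1g -mulgA mulVg mulg1.
by rewrite /conjg invgK !mulgA.
Qed.

(** Since [p <= f], multiplying the commutation relations by [p] shows that [g] normalizes
    [natural_connection p]. *)
Lemma commute_mod_commute f p g : center_of mul setT f -> idempotents p ->
  p * f = p ->
  (forall x, natural_connection p x ->
     f * uval g * uval x = f * uval x * uval g) ->
  p * uval g = uval g * p.
Proof.
move=> [_ fc] pp pf com; apply: conj_stable_commute => // x; split=> px.
  have := com _ px; rewrite !uvalM.
  rewrite !mulSA mul_unitVK fc // -!mulSA => /(congr1 (mul (uval g^-1))).
  rewrite !mulSA uvalVl !mul1g => /(congr1 (mul p)).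
  move: px; rewrite !natural_connectionE.
  rewrite !uvalM.
  by rewrite !mulSA pf => ->.
rewrite !natural_connectionE !uvalM.
have := congr1 (mul p) (com _ px); rewrite !mulSA pf => ->.
by rewrite px mul_unitK.
Qed.

Lemma F_commute_iff e e' f :
  idempotents e -> idempotents e' -> idempotents f ->
  center_of mul setT e -> center_of mul setT e' -> center_of mul setT f ->
  nat_le e f -> nat_le e' f ->
  commute_on mul (F_set e f) (F_set e' f) <->
  commute_on (@set_mul _)
    (quotient_set (natural_connection e) (natural_connection f))
    (quotient_set (natural_connection e') (natural_connection f)).
Proof.
move=> ee ee' ff ec ec' fc /(nat_le_mul ff) ef /(nat_le_mul ff) ef'.
have [_ fC] := fc.
have mulff a b : f * a * (f * b) = f * a * b.
  by rewrite mulSA (fC a) // -(mulSA a) ff.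
split=> [com _ _ [g eg <-] [h eh <-] | com _ _ [s es <-] [t et <-]].
  apply/coset_commute_iff => //.
  have := com (f * uval g) (f * uval h); rewrite !mulff; apply.
    by exists (uval g) => //; exists e.
  by exists (uval h) => //; exists e'.
have {}com g h : natural_connection e g -> natural_connection e' h ->
    f * uval g * uval h = f * uval h * uval g.
  by move=> eg eh; apply/coset_commute_iff => //; apply: com; [exists g | exists h].
have [k [g [kk ek eg ->]]] := up_set_factorization ec ee es.
have [l [h [ll el eh ->]]] := up_set_factorization ec' ee' et.
have fk := idempotentsM ff kk; have fl := idempotentsM ff ll.
have mulfK a : f * a * f = f * a by rewrite -mulSA -fC // mulSA ff.
(* Here [d <= f * a], so the stabilizer of [f * a] lies in that of [d], where [com] applies. *)
have sub d a x : d * f = d -> d * a = d -> natural_connection (f * a) x ->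
    natural_connection d x.
  by move=> df da /(congr1 (mul d)); rewrite !natural_connectionE !mulSA df da.
have kh : f * k * uval h = uval h * (f * k).
  by apply: (commute_mod_commute fc fk (mulfK k)) => x px; apply/esym/com => //; exact: (sub e k).
have lg : f * l * uval g = uval g * (f * l).
  by apply: (commute_mod_commute fc fl (mulfK l)) => x px; apply: com => //; exact: (sub e' l).
(* Both products acquire the same idempotent factor [f * k * (f * l)], leaving only [g * h] against
   [h * g] modulo [f]. *)
have -> : f * (k * uval g) * (f * (l * uval h)) = f * k * (f * l) * (uval g * uval h).
  by rewrite (mulSA f k) (mulSA f l) -(mulSA (f * k)) (mulSA (uval g)) -lg !mulSA.
have -> : f * (l * uval h) * (f * (k * uval g)) = f * k * (f * l) * (uval h * uval g).
  rewrite (idempotents_commute fk fl).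
  by rewrite (mulSA f k) (mulSA f l) -(mulSA (f * l)) (mulSA (uval h)) -kh !mulSA.
by rewrite -(mulfK l) -!mulSA (mulSA f (uval g)) com // !mulSA.
Qed.

(** * Chains of central idempotents and normal series *)

Lemma F_setS e f : F_set e f `<=` F_set zerog f.
Proof. by move=> _ [s _ <-]; exists s => //; exact: nat_le0. Qed.

Lemma central_chain_normal_series n (e : nat -> S) (H := fun i => natural_connection (e (n - i))) :
  central_idempotent_chain n e ->
  normal_series n H /\ forall i, (i <= n)%N -> natural_connection_image S (H i).
Proof.
move=> [e0 en ec eS]; split; last first.
  by move=> i _; exists (e (n - i)) => //; case: (ec _ (leq_subr i n)).
split=> [||i _|i ltin].
- by rewrite /H subn0 en natural_connection1.
- by rewrite /H subnn e0 natural_connection0.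
- by apply: central_natural_connection_normal; case: (ec _ (leq_subr i n)).
have le := leq_subr i n; have le' := leq_subr i.+1 n.
case: thetaS => _ _ /(_ (e (n - i.+1)) (e (n - i))) [].
- by case: (ec _ le').
- by case: (ec _ le).
move=> + _; apply; rewrite -(subnSK ltin); apply: eS.
by rewrite ltn_subrL; case: (n) ltin.
Qed.

Lemma normal_series_central_chain n (H : nat -> set (units S)) :
  normal_series n H -> (forall i, (i <= n)%N -> natural_connection_image S (H i)) ->
  exists2 e, central_idempotent_chain n e &
    forall i, (i <= n)%N -> H i = natural_connection (e (n - i)).
Proof.
move=> [H0 Hn Hnormal HS] imH.
have /choice [k kH] : forall i, exists k, (i <= n)%N ->
    idempotents k /\ natural_connection k = H i.
  move=> i; case: (leqP i n) => [/imH [k kk <-] | _]; first by exists k.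
  (* A default value for indices beyond [n]. *)
  by exists zerog.
exists (fun i => k (n - i)); last by move=> i lein; rewrite subKn //; case: (kH i lein).
split=> [||i lein|i ltin].
- rewrite subn0; have [kk kE] := kH n (leqnn n).
  apply: natural_connection_inj => //; first exact: idempotents0.
  by rewrite kE Hn natural_connection0.
- rewrite subnn; have [kk kE] := kH 0 (leq0n n).
  apply: natural_connection_inj => //; first exact: idempotents1.
  by rewrite kE H0 natural_connection1.
- have [kk kE] := kH _ (leq_subr i n); split=> //.
  by apply: normal_natural_connection_central => //; rewrite kE; apply/Hnormal/leq_subr.
have [kk kE] := kH _ (leq_subr i n); have [kk' kE'] := kH _ (leq_subr i.+1 n).
case: thetaS => _ _ /(_ _ _ kk kk') [_]; apply; rewrite kE kE' -(subnSK ltin).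
by apply: HS; rewrite ltn_subrL; case: (n) ltin.
Qed.

(* Covers both equivalences: [c] is constantly [0] for the nilpotent case and the
   identity for the solvable one. *)
Lemma commuting_series_iff (c : S -> S) (C : set (units S) -> set (units S)) :
  (forall e, idempotents e -> center_of mul setT e ->
     [/\ idempotents (c e), center_of mul setT (c e), nat_le (c e) e &
         natural_connection (c e) = C (natural_connection e)]) ->
  (exists n (e : nat -> S), central_idempotent_chain n e /\ forall i, (i < n)%N ->
     commute_on mul (F_set (e i) (e i.+1)) (F_set (c (e i)) (e i.+1))) <->
  (exists n H, (normal_series n H /\ forall i, (i < n)%N ->
     commute_on (@set_mul _) (quotient_set (H i.+1) (H i)) (quotient_set (C (H i.+1)) (H i))) /\
     forall i, (i <= n)%N -> natural_connection_image S (H i)).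
Proof.
move=> cC.
have step n (e : nat -> S) i : central_idempotent_chain n e -> (i < n)%N ->
    commute_on mul (F_set (e i) (e i.+1)) (F_set (c (e i)) (e i.+1)) <->
    commute_on (@set_mul _)
      (quotient_set (natural_connection (e i)) (natural_connection (e i.+1)))
      (quotient_set (C (natural_connection (e i))) (natural_connection (e i.+1))).
  move=> [_ _ ec eS] ltin; have [ei eic] := ec i (ltnW ltin).
  have [ei' eic'] := ec _ ltin; have [ci cic cle <-] := cC _ ei eic.
  apply: F_commute_iff => //; first exact: eS.
  (* Transitivity of the natural order: [c (e i) <= e i <= e i.+1]. *)
  exists (c (e i)) => //.
  by rewrite -(nat_le_mul ei cle) -mulSA (nat_le_mul ei' (eS _ ltin)).
split=> [[n [e [ce com]]] | [n [H [[nH com] imH]]]].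
  have [nH imH] := central_chain_normal_series ce.
  exists n, (fun i => natural_connection (e (n - i))); split=> //; split=> // i ltin.
  (* Reversal sends the factor at [i] to the link of the chain from [n - i.+1] to [n - i]. *)
  rewrite -(subnSK ltin); have lt : (n - i.+1 < n)%N by rewrite ltn_subrL; case: (n) ltin.
  by apply/(step n) => //; exact: com.
have [e ce HE] := normal_series_central_chain nH imH.
exists n, e; split=> // i ltin; apply/(step n) => //.
have lt : (n - i.+1 < n)%N by rewrite ltn_subrL; case: (n) ltin.
have := com _ lt; rewrite !HE ?(ltnW lt) //.
by rewrite subnSK // subKn ?(ltnW ltin) // subKn.
Qed.

End InverseMonoidTheory.

(** This brings both notions of central series to the [commute_on] form of
    [commuting_series_iff]. *)
Lemma subset_center_of (T : Type) (op : T -> T -> T) (A B : set T) :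
  A `<=` B -> (A `<=` center_of op B <-> commute_on op A B).
Proof.
move=> AB; split=> [AZ x y /AZ [_ xc] /xc // | com x Ax].
by split=> [|y By]; [exact: AB | exact: com].
Qed.

Lemma quotient_setS (G : groupType) (H N : set G) :
  quotient_set H N `<=` quotient_set setT N.
Proof. by move=> _ [x _ <-]; exists x. Qed.

Theorem theorem3p7 (S : inverseMonoid0Type)
    (factS : factorizable S) (thetaS : natural_connection_dual_iso S) :
  (G_nilpotent S <->
     nilpotent_group (units S) /\
     exists (n : nat) (H : nat -> set (units S)),
       central_series n H /\
       forall i : nat, (i <= n)%N -> natural_connection_image S (H i)) /\
  (G_solvable S <->
     solvable_group (units S) /\
     exists (n : nat) (H : nat -> set (units S)),
       abelian_series n H /\
       forall i : nat, (i <= n)%N -> natural_connection_image S (H i)).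
Proof.
split.
  (* [C] is constantly [setT] because every unit fixes [zerog]. *)
  have [SG GS] := commuting_series_iff factS thetaS (c := fun=> zerog) (C := fun=> setT)
    (fun e _ _ => And4 (@idempotents0 S) (@center0 S) (nat_le0 e) (@natural_connection0 S)).
  split=> [[n [e [ce ser]]] | [_ [n [H [[nH ser] imH]]]]].
    have [|m [H [[nH com] imH]]] := SG.
      exists n, e; split=> // i ltin.
      by apply/(subset_center_of _ (@F_setS _ _ _)); exact: ser.
    have cH : central_series m H.
      split=> // i ltim.
      by apply/(subset_center_of _ (@quotient_setS _ _ _)); exact: com.
    by split; exists m, H.
  have [|m [e [ce com]]] := GS.
    exists n, H; split=> //; split=> // i ltin.
    by apply/(subset_center_of _ (@quotient_setS _ _ _)); exact: ser.
  exists m, e; split=> // i ltim.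
  by apply/(subset_center_of _ (@F_setS _ _ _)); exact: com.
have [|SG GS] := commuting_series_iff factS thetaS (c := id) (C := id).
  by move=> e ee ec; split=> //; exists e.
(* With [c] and [C] the identity, [commute_on] of a set with itself unfolds to [commutative_on]. *)
split=> [/SG [n [H [aH imH]]] | [_ /GS //]].
by split; exists n, H.
Qed.
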